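(* Let $R$ be an integral domain, let $\mathcal F\subseteq\operatorname{Spec}(R)$ be a defining family for $R$, and let $\ast:=\wedge_{P\in\mathcal F}\ast_P$, where $\ast_P$ is a star operation on $R_P$ for each $P\in\mathcal F$. The following conditions are equivalent for an ideal $I$ of $R$: (i) $I$ is Clifford $\ast$-regular (respectively, $\ast$-stable); (ii) $IR_P$ is Clifford $\ast_P$-regular (respectively, $\ast_P$-stable) and $(I(I^\ast:I^2)R_P)^{\ast_P}=(IR_P((IR_P)^{\ast_P}:(IR_P)^2))^{\ast_P}$, for each $P\in\mathcal F$.
   Context: For an integral domain $R$ with field of fractions $K$, an ideal means a nonzero fractional ideal; $(J:I)=\{x\in K: xI\subseteq J\}$. A star operation on $R$ is a map $I\mapsto I^\ast$ on the set of ideals of $R$ such that for all $0\ne a\in K$ and ideals $I,J$: $R^\ast=R$ and $(aI)^\ast=aI^\ast$; $I\subseteq I^\ast$, and $I\subseteq J$ implies $I^\ast\subseteq J^\ast$; $I^{\ast\ast}=I^\ast$. A defining family for $R$ is a family $\mathcal F$ of pairwise incomparable prime ideals with $R=\bigcap_{P\in\mathcal F}R_P$. The operation $\wedge_{P\in\mathcal F}\ast_P$ is the star operation on $R$ given by $I\mapsto\bigcap_{P\in\mathcal F}(IR_P)^{\ast_P}$. An ideal $I$ is Clifford $\ast$-regular if there is an ideal $J$ of $R$ with $I^\ast=(I^2J)^\ast$; it is $\ast$-stable if, with $E:=(I^\ast:I^\ast)$, one has $(I^\ast(E:I^\ast))^\ast=E$. The same definitions are used for ideals of $R_P$ with $\ast_P$.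 *)

(* Defs.v *)
From mathcomp Require Import all_boot all_algebra ring_quotient.
From mathcomp Require Export fraction.
From mathcomp Require Export boolp classical_sets.

Set Implicit Arguments.
Unset Strict Implicit.
Unset Printing Implicit Defensive.

Import GRing.Theory.
Local Open Scope classical_set_scope.
Local Open Scope ring_scope.

(* Ideals of R and of its localizations R_P all live in the same field
   K = Frac R, so the notions below are relative to a subset D of a field K;
   they are meant for D a subring of K with field of fractions K. *)
Section Ideals.
Variables (K : fieldType) (D : set K).
Implicit Types I J : set K.

Definition fractional_ideal I :=
  [/\ I 0,
      (forall a x y, D a -> I x -> I y -> I (a * x + y)),
      (exists2 x, I x & x != 0) &
      (exists2 d, D d & d != 0 /\ (forall x, I x -> D (d * x)))].

Definition ideal_mul I J : set K :=
  [set x | exists n (a b : 'I_n -> K),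
     [/\ forall i, I (a i), forall i, J (b i) & x = \sum_(i < n) a i * b i]].

(* (J : I) *)
Definition ideal_colon J I : set K := [set x | forall y, I y -> J (x * y)].

Definition ideal_scale (a : K) I : set K := [set a * x | x in I].

(* Only the values of star at fractional ideals are meaningful. *)
Record star_operation (star : set K -> set K) : Prop := StarOperation {
  star_ideal : forall I, fractional_ideal I -> fractional_ideal (star I);
  star_unit : star D = D;
  star_scale : forall a I, a != 0 -> fractional_ideal I ->
    star (ideal_scale a I) = ideal_scale a (star I);
  star_ext : forall I, fractional_ideal I -> I `<=` star I;
  star_mono : forall I J, fractional_ideal I -> fractional_ideal J ->
    I `<=` J -> star I `<=` star J;
  star_idem : forall I, fractional_ideal I -> star (star I) = star I
}.

Definition clifford_regular (star : set K -> set K) I :=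
  exists2 J, fractional_ideal J & star I = star (ideal_mul (ideal_mul I I) J).

(* D enters only through star. *)
Definition star_stable (star : set K -> set K) I :=
  let E := ideal_colon (star I) (star I) in
  star (ideal_mul (star I) (ideal_colon E (star I))) = E.

End Ideals.

Section Localization.
Variable R : idomainType.
Local Notation K := {fraction R}.

Definition base_ring : set K := range (@tofrac R).

(* idealr_closed includes properness. *)
Definition prime_ideal (P : set R) :=
  idealr_closed (mem P) /\ prime_idealr_closed (mem P).

Definition localization (P : set R) : set K :=
  [set x | exists a s, ~ P s /\ x = tofrac a / tofrac s].

(* I R_P *)
Definition extend (I : set K) (P : set R) : set K :=
  ideal_mul I (localization P).

Definition defining_family (F : set (set R)) :=
  [/\ forall P, F P -> prime_ideal P,
      forall P Q, F P -> F Q -> P `<=` Q -> P = Q &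
      base_ring = \bigcap_(P in F) localization P].

Definition wedge (F : set (set R)) (star : set R -> set K -> set K)
    (I : set K) : set K :=
  \bigcap_(P in F) star P (extend I P).

End Localization.

Arguments base_ring R : clear implicits.

(* Main.v *)
Require Import Defs.
From mathcomp Require Import all_boot all_algebra fraction boolp classical_sets.
From mathcomp Require Import ring.

(** Put [J := (I^* : I^2)]. For any star operation, [I] is Clifford regular iff
    [I] is contained in [(I^2 J)^*], and [I] is stable iff [1] lies in
    [(I J)^*]; in particular stability implies Clifford regularity. Since
    [(I^* R_P)^*P = (I R_P)^*P], both membership conditions are local on the
    family, except that [J R_P] may be smaller than
    [J_P := ((I R_P)^*P : (I R_P)^2)]; the second condition in (ii) says that
    the difference disappears after multiplying by [I] and closing. If [I] is
    Clifford regular this holds automatically: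
    [I J_P] is contained in [(I^2 J J_P)^*P], hence in [(I J)^*P]. *)

Set Implicit Arguments.
Unset Strict Implicit.
Unset Printing Implicit Defensive.

Local Open Scope classical_set_scope.
Local Open Scope ring_scope.
Import GRing.Theory.

(** * Arithmetic of ideal products inside a field *)

Section FractionalIdeals.
Variable K : fieldType.
Implicit Types A B C I J : set K.

Lemma mem_ideal_mul A B a b : A a -> B b -> ideal_mul A B (a * b).
Proof.
move=> Aa Bb; exists 1%N, (fun=> a), (fun=> b).
by split=> //; rewrite big_ord1.
Qed.

Lemma ideal_mul0 A B : ideal_mul A B 0.
Proof.
by exists 0%N, (fun=> 0), (fun=> 0); split=> [[]//|[]//|]; rewrite big_ord0.
Qed.

Lemma ideal_mulD A B x y :
  ideal_mul A B x -> ideal_mul A B y -> ideal_mul A B (x + y).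
Proof.
move=> [m [a [b [Aa Bb ->]]]] [n [c [d [Ac Bd ->]]]].
pose glue (f : 'I_m -> K) (g : 'I_n -> K) (i : 'I_(m + n)) :=
  match split i with inl j => f j | inr k => g k end.
exists (m + n)%N, (glue a c), (glue b d); split.
- by move=> i; rewrite /glue; case: split.
- by move=> i; rewrite /glue; case: split.
- rewrite big_split_ord; congr (_ + _); apply: eq_bigr => i _; rewrite /glue.
    by rewrite -[lshift n i]/(unsplit (inl i)) unsplitK.
  by rewrite -[rshift m i]/(unsplit (inr i)) unsplitK.
Qed.

Lemma ideal_mul_sub A B C : C 0 -> (forall x y, C x -> C y -> C (x + y)) ->
  (forall a b, A a -> B b -> C (a * b)) -> ideal_mul A B `<=` C.
Proof.
move=> C0 CD CM _ [n [a [b [Aa Bb ->]]]].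
by apply: (big_ind C) => // i _; apply: CM.
Qed.

(** The elements [x] with [c * x] in [C] are closed under sums, so products of generators suffice.
    This form handles a fixed factor in front of a product. *)
Lemma ideal_mul_scale_sub A B C c :
  C 0 -> (forall x y, C x -> C y -> C (x + y)) ->
  (forall a b, A a -> B b -> C (c * (a * b))) ->
  forall x, ideal_mul A B x -> C (c * x).
Proof.
move=> C0 CD CM x [n [a [b [Aa Bb ->]]]]; rewrite mulr_sumr.
by apply: (big_ind C) => // i _; apply: CM.
Qed.

Lemma ideal_mulS A B A' B' :
  A `<=` A' -> B `<=` B' -> ideal_mul A B `<=` ideal_mul A' B'.
Proof.
move=> AA' BB'; apply: ideal_mul_sub; first exact: ideal_mul0.
- by move=> x y; apply: ideal_mulD.
- by move=> a b /AA' Aa /BB' Bb; apply: mem_ideal_mul.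
Qed.

Lemma ideal_mulC A B : ideal_mul A B = ideal_mul B A.
Proof.
suff sub (X Y : set K) : ideal_mul X Y `<=` ideal_mul Y X by apply/seteqP; split.
apply: ideal_mul_sub => [|x y|a b Xa Yb]; first exact: ideal_mul0.
  exact: ideal_mulD.
by rewrite mulrC; apply: mem_ideal_mul.
Qed.

Lemma ideal_mulA A B C :
  ideal_mul A (ideal_mul B C) = ideal_mul (ideal_mul A B) C.
Proof.
have sub (X Y Z : set K) :
  ideal_mul X (ideal_mul Y Z) `<=` ideal_mul (ideal_mul X Y) Z.
  apply: ideal_mul_sub => [|x y|a w Xa]; first exact: ideal_mul0.
    exact: ideal_mulD.
  move: w; apply: ideal_mul_scale_sub => [|x y|b c Yb Zc].
  - exact: ideal_mul0.
  - exact: ideal_mulD.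
  - by rewrite mulrA; apply: mem_ideal_mul => //; apply: mem_ideal_mul.
apply/seteqP; split; first exact: sub.
(* Commutativity turns the reverse inclusion into [sub] for the factors in reverse order. *)
rewrite (ideal_mulC _ C) (ideal_mulC A B) (ideal_mulC A) (ideal_mulC B C).
exact: sub.
Qed.

Lemma ideal_mulAC A B C :
  ideal_mul (ideal_mul A B) C = ideal_mul (ideal_mul A C) B.
Proof. by rewrite -!ideal_mulA (ideal_mulC B). Qed.

Lemma ideal_mul_scale a A B :
  ideal_mul (ideal_scale a A) B = ideal_scale a (ideal_mul A B).
Proof.
apply/seteqP; split.
  apply: ideal_mul_sub => [|_ _ [x ABx <-] [y ABy <-]|_ b [c Ac <-] Bb].
  - by exists 0; [apply: ideal_mul0|rewrite mulr0].
  - by exists (x + y); [apply: ideal_mulD|rewrite mulrDr].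
  - by exists (c * b); [apply: mem_ideal_mul|rewrite mulrA].
move=> _ [x ABx <-]; move: x ABx.
apply: ideal_mul_scale_sub => [|x y|c b Ac Bb].
- exact: ideal_mul0.
- exact: ideal_mulD.
- by rewrite mulrA; apply: mem_ideal_mul => //; exists c.
Qed.

(** * Fractional ideals over a base [D]: products and colons *)

Section Subring.
Variable D : set K.
(** Together the two hypotheses encode that [D] contains 0 and 1 and is closed under sums and
    products. *)
Hypothesis D1 : D 1.
Hypothesis fD : fractional_ideal D D.
Notation fractional := (fractional_ideal D).

Lemma fractional0 A : fractional A -> A 0. Proof. by case. Qed.

Lemma fractionalD A x y : fractional A -> A x -> A y -> A (x + y).
Proof. by case=> _ lin _ _ Ax Ay; rewrite -[x]mul1r; apply: lin. Qed.

Lemma fractionalM A d x : fractional A -> D d -> A x -> A (d * x).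
Proof.
by case=> A0 lin _ _ Dd Ax; rewrite -[d * x]addr0; apply: lin.
Qed.

Lemma fractional_mul A B :
  fractional A -> fractional B -> fractional (ideal_mul A B).
Proof.
move=> fA fB; have [_ _ [x Ax x0] [d Dd [d0 dA]]] := fA.
have [_ _ [y By y0] [e De [e0 eB]]] := fB; split.
- exact: ideal_mul0.
- move=> a u v Da ABu; apply: ideal_mulD; move: u ABu.
  apply: ideal_mul_scale_sub => [|u w|b c Ab Bc].
  + exact: ideal_mul0.
  + exact: ideal_mulD.
  + by rewrite mulrA; apply: mem_ideal_mul => //; apply: fractionalM.
- by exists (x * y); [apply: mem_ideal_mul|rewrite mulf_neq0].
- exists (d * e); first exact: fractionalM.
  split; first exact: mulf_neq0.
  apply: ideal_mul_scale_sub => [|u w|a b Aa Bb]; first exact: fractional0.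
    exact: fractionalD.
  by rewrite mulrACA; apply: fractionalM => //; [apply: dA|apply: eB].
Qed.

(** Since [e B] lies in [D], [x e B] lies in [A], which gives a nonzero element. For a denominator,
    [u y] lies in [A] for every [u] in the colon, [d] moves it into [D], and the further factor [e]
    is there so that [e y], hence the whole denominator, belongs to [D]. *)
Lemma fractional_colon A B :
  fractional A -> fractional B -> fractional (ideal_colon A B).
Proof.
move=> fA fB; have [_ _ [x Ax x0] [d Dd [d0 dA]]] := fA.
have [_ _ [y By y0] [e De [e0 eB]]] := fB; split.
- by move=> b _; rewrite mul0r; apply: fractional0.
- move=> a u v Da ABu ABv b Bb; rewrite mulrDl -mulrA.
  by apply: fractionalD => //; [apply: fractionalM => //; apply: ABu|apply: ABv].
- exists (x * e); last exact: mulf_neq0.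
  by move=> b Bb; rewrite -mulrA mulrC; apply: fractionalM => //; apply: eB.
- exists (d * (e * y)); first by apply: fractionalM => //; apply: eB.
  split; first by rewrite !mulf_neq0.
  move=> u ABu.
  have -> : d * (e * y) * u = e * (d * (u * y)) by ring.
  by apply: fractionalM => //; apply/dA/ABu.
Qed.

Lemma ideal_mul_colon A B : fractional A -> ideal_mul B (ideal_colon A B) `<=` A.
Proof.
move=> fA; apply: ideal_mul_sub => [|x y|b c Bb ABc]; first exact: fractional0.
  exact: fractionalD.
by rewrite mulrC; apply: ABc.
Qed.

Lemma ideal_colon_colon A B C : fractional A ->
  ideal_colon (ideal_colon A B) C = ideal_colon A (ideal_mul B C).
Proof.
move=> fA; apply/seteqP; split=> x xP.
  move=> v; apply: ideal_mul_scale_sub v => [|u w|b c Bb Cc].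
  - exact: fractional0.
  - exact: fractionalD.
  - by rewrite (mulrC b) mulrA; apply: xP.
by move=> c Cc b Bb; rewrite -mulrA (mulrC c); apply/xP/mem_ideal_mul.
Qed.

(** * Star operations, Clifford regularity and stability *)

Section StarOperation.
Variable star : set K -> set K.
Hypothesis star_op : star_operation D star.

Lemma fractional_star A : fractional A -> fractional (star A).
Proof. exact: (star_ideal star_op). Qed.

(** Monotonicity and idempotence combined: to compare closures it is enough to look at [A]
    itself. *)
Lemma star_le A B : fractional A -> fractional B ->
  A `<=` star B -> star A `<=` star B.
Proof.
move=> fA fB AB; rewrite -(star_idem star_op fB).
by apply: (star_mono star_op) => //; apply: fractional_star.
Qed.

(** If [x B] lies in [A^*] and [x] is nonzero, then [x B^* = (x B)^*] lies in [A^*] too. The case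
    [x = 0] is separate because the scaling axiom excludes it. *)
Lemma star_ideal_colon A B : fractional A -> fractional B ->
  ideal_colon (star A) (star B) = ideal_colon (star A) B.
Proof.
move=> fA fB; have fA' := fractional_star fA.
apply/seteqP; split=> x xP b Bb; first exact/xP/(star_ext star_op).
have [->|x0] := eqVneq x 0; first by rewrite mul0r; apply: fractional0.
have [_ lin [y By y0] [d Dd [d0 dB]]] := fB.
(* A denominator of [A^*] serves for [x B], which it contains. *)
have fxB : fractional (ideal_scale x B).
  split.
  - by exists 0; [apply: fractional0|rewrite mulr0].
  - move=> a _ _ Da [u Bu <-] [v Bv <-]; exists (a * u + v); first exact: lin.
    by rewrite mulrDr mulrCA.
  - by exists (x * y); [exists y|rewrite mulf_neq0].
  - have [_ _ _ [e De [e0 eA]]] := fA'.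
    exists e => //; split=> // _ [u Bu <-]; exact/eA/xP.
have : star (ideal_scale x B) `<=` star A.
  by apply: star_le => // _ [u Bu <-]; apply: xP.
by rewrite (star_scale star_op x0 fB); apply; exists b.
Qed.

(** Each [b] in [B] multiplies [A] into [(A B)^*], hence also [A^*] by [star_ideal_colon]. *)
Lemma star_mull A B : fractional A -> fractional B ->
  star (ideal_mul (star A) B) = star (ideal_mul A B).
Proof.
move=> fA fB; have fAB := fractional_mul fA fB.
have fA' := fractional_star fA; have fAB' := fractional_star fAB.
apply/seteqP; split; last first.
  apply: (star_mono star_op) => //; first exact: fractional_mul.
  by apply: ideal_mulS => //; apply: (star_ext star_op).
apply: star_le => //; first exact: fractional_mul.
apply: ideal_mul_sub => [|x y|a b As Bb]; first exact: fractional0.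
  exact: fractionalD.
have : ideal_colon (star (ideal_mul A B)) (star A) b.
  rewrite star_ideal_colon // => c Ac; rewrite mulrC.
  exact/(star_ext star_op)/mem_ideal_mul.
by rewrite mulrC; apply.
Qed.

Lemma star_mulr A B : fractional A -> fractional B ->
  star (ideal_mul A (star B)) = star (ideal_mul A B).
Proof. by move=> fA fB; rewrite !(ideal_mulC A) star_mull. Qed.

(* The canonical candidate for [J] in the definition of Clifford regularity. *)
Definition quasi_inverse I := ideal_colon (star I) (ideal_mul I I).

Lemma fractional_quasi_inverse I :
  fractional I -> fractional (quasi_inverse I).
Proof.
move=> fI; apply: fractional_colon; first exact: fractional_star.
exact: fractional_mul.
Qed.

(** Every witness [J] lies in [quasi_inverse I], and [I^2 (I^* : I^2)] never leaves [I^*]; so the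
    largest candidate works as soon as some candidate does. *)
Lemma clifford_regularP I : fractional I ->
  clifford_regular D star I <->
  star I = star (ideal_mul (ideal_mul I I) (quasi_inverse I)).
Proof.
move=> fI; have fI' := fractional_star fI; have fII := fractional_mul fI fI.
have fJ := fractional_quasi_inverse fI.
split=> [[J fJ0 IJ]|eqI]; last by exists (quasi_inverse I).
have JI : J `<=` quasi_inverse I.
  move=> x Jx y IIy; rewrite IJ mulrC.
  by apply: (star_ext star_op); [apply: fractional_mul|apply: mem_ideal_mul].
apply/seteqP; split.
  rewrite IJ; apply: (star_mono star_op); [exact: fractional_mul..|].
  exact: ideal_mulS.
apply: star_le => //; first exact: fractional_mul.
exact: ideal_mul_colon.
Qed.

Lemma star_stableP I : fractional I ->
  star_stable star I <-> star (ideal_mul I (quasi_inverse I)) 1.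
Proof.
move=> fI; have fI' := fractional_star fI; have fII := fractional_mul fI fI.
have fJ := fractional_quasi_inverse fI.
have fIJ := fractional_mul fI fJ; have fIJ' := fractional_star fIJ.
rewrite /star_stable ideal_colon_colon //.
(* The two stars are dropped in turn, each starred factor being moved into the inner colon, whose
   numerator is [star I]. *)
have -> : ideal_colon (star I) (ideal_mul (star I) (star I)) = quasi_inverse I.
  rewrite -ideal_colon_colon // !star_ideal_colon // ideal_colon_colon //.
  by rewrite ideal_mulC -ideal_colon_colon // star_ideal_colon // ideal_colon_colon.
rewrite star_mull //; split=> [->|IJ1]; first by move=> x; rewrite mul1r.
set E := ideal_colon _ _; have fE : fractional E by exact: fractional_colon.
(* [E] is closed because [E^* I] lies in [(E I)^*], hence in [I^*]. *)
have EE : star E `<=` E.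
  move=> e Ee; rewrite /E star_ideal_colon // => x Ix.
  suff /(_ (e * x)) : star (ideal_mul (star E) I) `<=` star I.
    apply; apply: (star_ext star_op); last exact: mem_ideal_mul.
    by apply: fractional_mul => //; apply: fractional_star.
  rewrite star_mull //; apply: star_le => //; first exact: fractional_mul.
  rewrite ideal_mulC /E star_ideal_colon //; exact: ideal_mul_colon.
apply/seteqP; split.
  apply: subset_trans EE; apply: (star_mono star_op) => //.
  (* [I J] lies in [E] because [(I J) I = I^2 J] lies in [I^*]. *)
  rewrite /E star_ideal_colon // => _ [n [a [b [Ia Jb ->]]]] x Ix.
  rewrite mulr_suml; apply: (big_ind (star I)) => [|u v|i _].
  - exact: fractional0.
  - exact: fractionalD.
  - by rewrite mulrAC mulrC; apply/Jb/mem_ideal_mul.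
move=> e Ee.
(* Multiplication by [e] preserves [quasi_inverse I], hence [I J] and its closure; it is then
   applied to 1. *)
have : ideal_colon (star (ideal_mul I (quasi_inverse I)))
                   (star (ideal_mul I (quasi_inverse I))) e.
  rewrite star_ideal_colon //; apply: ideal_mul_scale_sub => [|u v|a b Ia Jb].
  - exact: fractional0.
  - exact: fractionalD.
  - rewrite mulrCA; apply: (star_ext star_op) => //; apply: mem_ideal_mul => //.
    by move=> x IIx; rewrite -mulrA; apply/Ee/Jb.
by move/(_ 1 IJ1); rewrite mulr1.
Qed.

(** As 1 lies in [(I J)^*], [I] lies in [I (I J)^*], whose closure is [(I^2 J)^*]. *)
Lemma stable_clifford_regular I : fractional I ->
  star_stable star I -> clifford_regular D star I.
Proof.
move=> fI /(star_stableP fI) IJ1; apply/(clifford_regularP fI).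
have fI' := fractional_star fI; have fII := fractional_mul fI fI.
have fJ := fractional_quasi_inverse fI; have fIJ := fractional_mul fI fJ.
apply/seteqP; split; last first.
  apply: star_le => //; first exact: fractional_mul.
  exact: ideal_mul_colon.
apply: star_le => //; first exact: fractional_mul.
rewrite -ideal_mulA -star_mulr // => x Ix; rewrite -[x]mulr1.
apply: (star_ext star_op); last exact: mem_ideal_mul.
by apply: fractional_mul => //; apply: fractional_star.
Qed.

(** With [Q = quasi_inverse I], [I Q] lies in the closure of [I^2 J Q = (I^2 Q) J], hence in that of
    [I J]; conversely [J] lies in [Q]. Over [R_P], with [J] extended from the global quasi-inverse,
    this is the second condition in (ii). *)
Lemma star_mul_quasi_inverse I J : fractional I -> fractional J ->
  star I = star (ideal_mul (ideal_mul I I) J) ->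
  star (ideal_mul I (quasi_inverse I)) = star (ideal_mul I J).
Proof.
move=> fI fJ0 IJ; have fI' := fractional_star fI.
have fII := fractional_mul fI fI; have fJ := fractional_quasi_inverse fI.
have fIJ0 := fractional_mul fI fJ0.
apply/seteqP; split.
  rewrite -star_mull // IJ star_mull //; last exact: fractional_mul.
  rewrite ideal_mulAC -star_mull //; last exact: fractional_mul.
  rewrite -[X in _ `<=` X]star_mull //.
  apply: (star_mono star_op).
  - by apply: fractional_mul => //; apply/fractional_star/fractional_mul.
  - exact: fractional_mul.
  apply: ideal_mulS => //; apply: star_le => //; first exact: fractional_mul.
  exact: ideal_mul_colon.
apply: (star_mono star_op); [exact: fractional_mul..|].
apply: ideal_mulS => // x Jx y IIy; rewrite IJ mulrC.
by apply: (star_ext star_op); [apply: fractional_mul|apply: mem_ideal_mul].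
Qed.

End StarOperation.
End Subring.
End FractionalIdeals.

(** * Localizations and extension of ideals to them *)

Section Localization.
Variable R : idomainType.
Notation K := {fraction R}.
Implicit Types (A B I J : set K) (P : set R).

Lemma base_ring1 : base_ring R 1.
Proof. by exists 1 => //; rewrite tofrac1. Qed.

Lemma fractional_base_ring : fractional_ideal (base_ring R) (base_ring R).
Proof.
split.
- by exists 0 => //; rewrite tofrac0.
- move=> _ _ _ [a _ <-] [x _ <-] [y _ <-].
  by exists (a * x + y) => //; rewrite tofracD tofracM.
- by exists 1; [apply: base_ring1|apply: oner_neq0].
- exists 1; first exact: base_ring1.
  by split=> [|x Rx]; [apply: oner_neq0|rewrite mul1r].
Qed.

Lemma base_ring_sub_localization P :
  prime_ideal P -> base_ring R `<=` localization P.
Proof.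
move=> [[_ /negP nP1 _] _] _ [a _ <-]; exists a, 1; split.
  by move=> P1; apply: nP1; rewrite inE.
by rewrite tofrac1 divr1.
Qed.

Section Prime.
Variable P : set R.
Hypothesis prP : prime_ideal P.
Notation L := (localization P).

Lemma localization1 : L 1.
Proof. exact/(base_ring_sub_localization prP)/base_ring1. Qed.

Lemma fractional_localization : fractional_ideal L L.
Proof.
have [[P0 _ _] primeP] := prP.
have nPM s t : ~ P s -> ~ P t -> ~ P (s * t).
  by move=> Ps Pt Pst; have := primeP s t; rewrite !inE => /(_ Pst) /orP[];
     rewrite inE.
have nz s : ~ P s -> tofrac s != 0.
  by rewrite tofrac_eq0; apply: contra_not_neq => ->; rewrite inE in P0.
split.
- by apply: (base_ring_sub_localization prP); exists 0 => //; rewrite tofrac0.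
- move=> _ _ _ [a [s [Ps ->]]] [x [t [Pt ->]]] [y [u [Pu ->]]].
  exists (a * x * u + y * (s * t)), (s * t * u); split.
    exact/nPM/Pu/nPM.
  rewrite !(tofracD, tofracM) mulf_div addf_div ?mulf_neq0 ?nz //.
- by exists 1; [apply: localization1|apply: oner_neq0].
- exists 1; first exact: localization1.
  by split=> [|x Lx]; [apply: oner_neq0|rewrite mul1r].
Qed.

Lemma ideal_mul_localization : ideal_mul L L = L.
Proof.
apply/seteqP; split=> [|x Lx].
  apply: ideal_mul_sub => [|x y|a b].
  - exact: (fractional0 fractional_localization).
  - exact: (fractionalD localization1 fractional_localization).
  - exact: (fractionalM fractional_localization).
by rewrite -[x]mulr1; apply: mem_ideal_mul => //; apply: localization1.
Qed.

Lemma sub_extend I : I `<=` extend I P.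
Proof.
by move=> x Ix; rewrite -[x]mulr1; apply: mem_ideal_mul => //; apply: localization1.
Qed.

(** [R_P = R_P R_P] supplies one copy of [R_P] for each factor. *)
Lemma extend_mul A B :
  extend (ideal_mul A B) P = ideal_mul (extend A P) (extend B P).
Proof.
rewrite /extend -{1}ideal_mul_localization !ideal_mulA.
by rewrite (ideal_mulAC A B).
Qed.

(** A denominator of [I] over [R] is one of [I R_P] over [R_P]. *)
Lemma fractional_extend I :
  fractional_ideal (base_ring R) I -> fractional_ideal L (extend I P).
Proof.
move=> [I0 lin [x Ix x0] [d Rd [d0 dI]]]; have fL := fractional_localization.
split.
- exact: ideal_mul0.
- move=> a u v La Iu; apply: ideal_mulD; move: u Iu.
  apply: ideal_mul_scale_sub => [|u w|b c Ib Lc].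
  + exact: ideal_mul0.
  + exact: ideal_mulD.
  + by rewrite mulrCA; apply: mem_ideal_mul => //; apply: (fractionalM fL).
- by exists x => //; apply: sub_extend.
- exists d; first exact: (base_ring_sub_localization prP).
  split=> //; apply: ideal_mul_scale_sub => [|u w|a b Ia Lb].
  + exact: (fractional0 fL).
  + exact: (fractionalD localization1 fL).
  + rewrite mulrA; apply: (fractionalM fL) => //.
    exact/(base_ring_sub_localization prP)/dI.
Qed.

End Prime.

(** * The wedge of local star operations is a star operation *)

Section Wedge.
Variables (F : set (set R)) (starP : set R -> set K -> set K).
Hypothesis famF : defining_family F.
Hypothesis starF : forall P, F P -> star_operation (localization P) (starP P).
Notation star := (wedge F starP).
Notation fractional := (fractional_ideal (base_ring R)).

Let primeF P : F P -> prime_ideal P. Proof. by case: famF => + _ _; apply. Qed.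

(** [star A] lies between [A] and [starP P (extend A P)], one of the sets being intersected. This
    gives idempotence of the wedge and carries global identities to [R_P]. *)
Lemma star_extend_wedge P A : F P -> fractional A -> fractional (star A) ->
  starP P (extend (star A) P) = starP P (extend A P).
Proof.
move=> FP fA fA'; have prP := primeF FP; have sP := starF FP.
have L1 := localization1 prP; have fL := fractional_localization prP.
have feA := fractional_extend prP fA; have feA' := fractional_extend prP fA'.
have fseA := fractional_star sP feA.
have sub : A `<=` star A.
  by move=> x Ax Q FQ; apply: (star_ext (starF FQ));
     [apply: fractional_extend => //; apply: primeF
     |apply: sub_extend => //; apply: primeF].
apply/seteqP; split; last first.
  by apply: (star_mono sP) => //; apply: ideal_mulS.
apply: (star_le sP) => //; apply: ideal_mul_sub => [|x y|a b Aa Lb].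
- exact: (fractional0 fseA).
- exact: (fractionalD L1 fseA).
- by rewrite mulrC; apply: (fractionalM fseA) => //; apply: Aa.
Qed.

Lemma wedge_fractional A : fractional A -> fractional (star A).
Proof.
move=> fA; have [A0 _ [x Ax x0] [d Rd [d0 dA]]] := fA.
have loc P : F P -> [/\ fractional_ideal (localization P) (extend A P),
    fractional_ideal (localization P) (starP P (extend A P)),
    star_operation (localization P) (starP P) & prime_ideal P].
  move=> FP; have feA := fractional_extend (primeF FP) fA.
  by split; [|apply: (fractional_star (starF FP))|apply: starF|apply: primeF].
split.
- by move=> P /loc[_ /fractional0].
- move=> a u v Ra Au Av P FP; have [_ [_ lin _ _] _ prP] := loc P FP.
  by apply: lin; [apply: (base_ring_sub_localization prP)|apply: Au|apply: Av].
- exists x => // P /loc[feA _ sP prP].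
  by apply: (star_ext sP) => //; apply: sub_extend.
(* From [d A] in [R] follows that [d] multiplies [A R_P], and then its closure, into [R_P]. The
   intersection of the [R_P] is [R], so the same [d] serves [star A]. *)
- exists d => //; split=> // y Ay; have [_ _ ->] := famF => P FP.
  have [feA _ sP prP] := loc P FP.
  have L1 := localization1 prP; have fL := fractional_localization prP.
  suff : ideal_colon (starP P (localization P)) (starP P (extend A P)) d.
    by rewrite (star_unit sP); apply; apply: Ay.
  rewrite (star_ideal_colon sP) // (star_unit sP).
  apply: ideal_mul_scale_sub => [|u w|a b Aa Lb].
  + exact: (fractional0 fL).
  + exact: (fractionalD L1 fL).
  + rewrite mulrA; apply: (fractionalM fL) => //.
    exact/(base_ring_sub_localization prP)/dA.
Qed.

Lemma wedge_star_operation : star_operation (base_ring R) star.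
Proof.
split.
- exact: wedge_fractional.
- have [_ _ ->] := famF; apply: eq_bigcapr => P FP.
  (* This is [R R_P = R_P], with [R] in the guise of the intersection. *)
  have -> : extend (\bigcap_(Q in F) localization Q) P = localization P.
    have [_ _ <-] := famF; rewrite -[RHS](ideal_mul_localization (primeF FP)).
    apply/seteqP; split.
      by apply: ideal_mulS => //; apply/base_ring_sub_localization/primeF.
    rewrite ideal_mul_localization; last exact: primeF.
    move=> x Lx; rewrite -[x]mul1r; apply: mem_ideal_mul => //.
    exact: base_ring1.
  exact: (star_unit (starF FP)).
- move=> a A a0 fA; apply/seteqP; split=> [x Ax|_ [x Ax <-] P FP].
    exists (a^-1 * x); last by rewrite mulVKf.
    move=> P FP; have := Ax P FP; rewrite /extend ideal_mul_scale.
    rewrite (star_scale (starF FP)) //; last exact: (fractional_extend (primeF FP) fA).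
    by move=> [y Ay <-]; rewrite mulKf.
  rewrite /extend ideal_mul_scale (star_scale (starF FP)) //; last first.
    exact: (fractional_extend (primeF FP) fA).
  by exists x => //; apply: Ax.
- move=> A fA x Ax P FP; have prP := primeF FP.
  by apply: (star_ext (starF FP));
    [exact: (fractional_extend prP fA)|apply: (sub_extend prP)].
- move=> A B fA fB AB x Ax P FP; have prP := primeF FP; move: (Ax P FP).
  by apply: (star_mono (starF FP)); [exact: fractional_extend..|apply: ideal_mulS].
- move=> A fA; apply: eq_bigcapr => P FP.
  by apply: star_extend_wedge => //; apply: wedge_fractional.
Qed.

End Wedge.
End Localization.

(** * Passage between global and local conditions *)

Unset Implicit Arguments.

Theorem proposition2p10 (R : idomainType) (F : set (set R))
    (starP : set R -> set {fraction R} -> set {fraction R})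
    (hF : defining_family F)
    (hstar : forall P, F P -> star_operation (localization P) (starP P))
    (I : set {fraction R}) (hI : fractional_ideal (base_ring R) I) :
  let star := wedge F starP in
  let compat P :=
    starP P (extend (ideal_mul I (ideal_colon (star I) (ideal_mul I I))) P) =
    starP P (ideal_mul (extend I P)
      (ideal_colon (starP P (extend I P))
                   (ideal_mul (extend I P) (extend I P)))) in
  (clifford_regular (base_ring R) star I <->
   forall P, F P ->
     clifford_regular (localization P) (starP P) (extend I P) /\ compat P) /\
  (star_stable star I <->
   forall P, F P -> star_stable (starP P) (extend I P) /\ compat P).
Proof.
move=> star compat.
have star_op : star_operation (base_ring R) star.
  exact: wedge_star_operation.
have R1 := base_ring1 R; have fR := fractional_base_ring R.
set J := ideal_colon (star I) (ideal_mul I I).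
have fJ : fractional_ideal (base_ring R) J.
  exact: (fractional_quasi_inverse R1 fR star_op).
have fIJ := fractional_mul R1 fR hI fJ.
have prF P : F P -> prime_ideal P by case: hF => + _ _; apply.
have fE P A : F P -> fractional_ideal (base_ring R) A ->
    fractional_ideal (localization P) (extend A P).
  by move=> /prF prP; apply: (fractional_extend prP).
have cliffordP := clifford_regularP R1 fR star_op hI.
have stableP := star_stableP R1 fR star_op hI.
(* Stated apart because the stable case also takes [compat] from it, through Clifford regularity. *)
have to_local : clifford_regular (base_ring R) star I -> forall P, F P ->
    clifford_regular (localization P) (starP P) (extend I P) /\ compat P.
  move=> /cliffordP eqI P FP; have prP := prF P FP.
  have L1 := localization1 prP; have fL := fractional_localization prP.
  (* The identity [I^* = (I^2 J)^*] extended to [R_P], with the global stars absorbed by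
     [starP P]. *)
  have eqP : starP P (extend I P) =
      starP P (ideal_mul (ideal_mul (extend I P) (extend I P)) (extend J P)).
    have fIIJ := fractional_mul R1 fR (fractional_mul R1 fR hI hI) fJ.
    rewrite -!extend_mul // -(star_extend_wedge hF hstar FP hI).
      rewrite -/star eqI star_extend_wedge //; exact: star_ideal.
    exact: (star_ideal star_op).
  split; first by exists (extend J P) => //; apply: fE.
  rewrite /compat extend_mul //; symmetry.
  apply: (star_mul_quasi_inverse L1 fL (hstar P FP)) eqP; exact: fE.
split; split.
- exact: to_local.
(* Both closures are intersections over [F], so they are compared at each [P]. *)
- move=> loc; apply/cliffordP; apply: eq_bigcapr => P FP.
  have [clP compP] := loc P FP; have prP := prF P FP; have sP := hstar P FP.
  have L1 := localization1 prP; have fL := fractional_localization prP.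
  have fIP := fE P I FP hI.
  have fQ := fractional_quasi_inverse L1 fL sP fIP.
  (* Grouping [I^2 J] as [I (I J)] isolates the factor that [compP] replaces under the star by its
     local counterpart. *)
  rewrite -[ideal_mul (ideal_mul I I) _]ideal_mulA extend_mul //.
  rewrite -[RHS](star_mulr L1 fL sP) //; last exact: fE.
  rewrite compP (star_mulr L1 fL sP) //; last exact: fractional_mul.
  by rewrite ideal_mulA; apply/(clifford_regularP L1 fL sP fIP).
- move=> stI P FP; have prP := prF P FP; have sP := hstar P FP.
  have L1 := localization1 prP; have fL := fractional_localization prP.
  have [_ compP] := to_local (stable_clifford_regular R1 fR star_op hI stI) P FP.
  split=> //; apply/(star_stableP L1 fL sP (fE P I FP hI)).
  by rewrite -compP; move/stableP: stI; apply.
(* Membership of 1 in the wedge is membership in each local closure, which [compP] identifies with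
   the one in the local criterion. *)
- move=> loc; apply/stableP => P FP.
  have [stP compP] := loc P FP; have prP := prF P FP; have sP := hstar P FP.
  have L1 := localization1 prP; have fL := fractional_localization prP.
  rewrite [X in X 1]compP.
  exact/(star_stableP L1 fL sP (fE P I FP hI)).
Qed.
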